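(* Let $X$ be a real Banach space and let $M \subset X$ be an $M$-ideal in $X$. If $X^*$ has the $w^*$-diameter two property, then $M^*$ has the $w^*$-diameter two property.
   Context: All Banach spaces are real and nonzero (in particular $M \neq \{0\}$). For a Banach space $Z$, $Z^*$ is its dual and $B_Z$ its closed unit ball. Diameters are taken with respect to the norm. $M$-ideals. A linear projection $P$ on a Banach space $Z$ is an $L$-projection if $\|z\| = \|Pz\| + \|z - Pz\|$ for all $z \in Z$. For a subspace $M \subseteq X$, its annihilator is $M^\perp = \{x^* \in X^* : x^*(m) = 0 \ \forall m \in M\}$. A closed subspace $M \subseteq X$ is an $M$-ideal in $X$ if there is an $L$-projection $P : X^* \to X^*$ with $\ker P = M^\perp$. For a Banach space $Z$, the dual space $Z^*$ has the $w^*$-diameter two property ($w^*$-D2P) if every nonempty relatively $w^*$-open subset of $B_{Z^*}$ has diameter $2$, where $w^*$ is the topology $\sigma(Z^*, Z)$. *)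

(* Defs.v *)
From HB Require Import structures.
From mathcomp Require Import all_boot all_order all_algebra.
From mathcomp Require Import all_classical all_reals all_analysis.
Set Implicit Arguments.
Unset Strict Implicit.
Unset Printing Implicit Defensive.
Import Order.TTheory GRing.Theory Num.Theory.
Import numFieldNormedType.Exports.
Local Open Scope classical_set_scope.
Local Open Scope ring_scope.

Section dual.
Context {R : realType} (V : normedModType R).

Definition dual_pred : {pred V -> R^o} :=
  mem [set f : V -> R^o | linear f /\ continuous f].

Lemma dual_submod_closed : submod_closed dual_pred.
Proof.
split.
  rewrite inE; split; last by move=> x; exact: cvg_cst.
  by move=> a u v; change (0 = a *: 0 + 0 :> R^o); rewrite scaler0 addr0.
move=> a f g; rewrite !inE => -[lf cf] [lg cg]; split.
  move=> b u v.
  change (a *: f (b *: u + v) + g (b *: u + v) =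
    b *: (a *: f u + g u) + (a *: f v + g v)); rewrite lf lg.
  by rewrite !scalerDr !scalerA (mulrC a b) addrACA.
by move=> x; apply: cvgD; [apply: cvgZr; exact: cf|exact: cg].
Qed.

HB.instance Definition _ :=
  GRing.isSubmodClosed.Build R (V -> R^o) dual_pred dual_submod_closed.

Record dual : Type := Dual {
  dual_fun :> V -> R^o ;
  dual_funP : dual_fun \in dual_pred }.

HB.instance Definition _ := [isSub for dual_fun].
HB.instance Definition _ := [Choice of dual by <:].
HB.instance Definition _ := [SubChoice_isSubLmodule of dual by <:].

Lemma dual_linear (f : dual) : linear f.
Proof. by have := dual_funP f; rewrite inE => -[]. Qed.

Lemma dual_continuous (f : dual) : continuous f.
Proof. by have := dual_funP f; rewrite inE => -[]. Qed.

HB.instance Definition _ (f : dual) :=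
  GRing.isLinear.Build R V R^o *:%R (dual_fun f) (dual_linear f).

Lemma dualDE (f g : dual) x : (f + g) x = f x + g x. Proof. by []. Qed.

Lemma dualZE a (f : dual) x : (a *: f) x = a * f x. Proof. by []. Qed.

Definition dual_norm (f : dual) : R := sup [set `|f x| | x in [set x | `|x| <= 1]].

Lemma dual_has_sup (f : dual) : has_sup [set `|f x| | x in [set x | `|x| <= 1]].
Proof.
split; first by exists `|f 0|; exists 0 => //=; rewrite normr0.
have /linear_bounded_continuous/bounded_funP/(_ 1)[M fM] :
  continuous (f : {linear V -> R^o}) by exact: dual_continuous.
by exists M => _ [x x1 <-]; exact: fM.
Qed.

Lemma dual_norm_ub (f : dual) x : `|x| <= 1 -> `|f x| <= dual_norm f.
Proof.
by move=> x1; apply: ub_le_sup; [case: (dual_has_sup f)|exists x].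
Qed.

Lemma dual_norm_le (f : dual) (c : R) :
  (forall x, `|x| <= 1 -> `|f x| <= c) -> dual_norm f <= c.
Proof.
move=> fc; apply: ge_sup; first by case: (dual_has_sup f).
by move=> _ [x x1 <-]; exact: fc.
Qed.

Lemma dual_norm_ge0 (f : dual) : 0 <= dual_norm f.
Proof.
by apply: le_trans (normr_ge0 (f 0)) _; apply: dual_norm_ub; rewrite normr0.
Qed.

Lemma dual_ler_normD (f g : dual) : dual_norm (f + g) <= dual_norm f + dual_norm g.
Proof.
apply: dual_norm_le => x x1; apply: le_trans (ler_normD _ _) _.
by apply: lerD; exact: dual_norm_ub.
Qed.

Let dual_normZ_le a (f : dual) : dual_norm (a *: f) <= `|a| * dual_norm f.
Proof.
apply: dual_norm_le => x x1.
by rewrite dualZE normrM ler_wpM2l//; exact: dual_norm_ub.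
Qed.

Lemma dual_normrZ a (f : dual) : dual_norm (a *: f) = `|a| * dual_norm f.
Proof.
apply/eqP; rewrite eq_le dual_normZ_le /=.
have [->|a0] := eqVneq a 0; first by rewrite normr0 mul0r dual_norm_ge0.
rewrite -ler_pdivlMl ?normr_gt0// -normfV.
by rewrite -[leLHS](congr1 dual_norm (scalerK a0 f)).
Qed.

Lemma dual_normr0_eq0 (f : dual) : dual_norm f = 0 -> f = 0.
Proof.
move=> f0; apply/val_inj/funext => x; change (f x = 0).
have [->|x0] := eqVneq x 0; first exact: raddf0.
have nx0 : `|x| != 0 by rewrite normr_eq0.
have : `|f (`|x|^-1 *: x)| <= 0.
  by rewrite -f0 dual_norm_ub// normrZ normfV normr_id mulVf.
rewrite normr_le0 linearZ /= scaler_eq0 invr_eq0 (negbTE nx0) /=.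
by move/eqP.
Qed.

HB.instance Definition _ := Lmodule_isNormed.Build R dual
  dual_ler_normD dual_normrZ dual_normr0_eq0.

End dual.

Section submodule.
Context {R : realType} {X : normedModType R} (M : submodClosed X).

Record submodule : Type := Submodule {
  submodule_val :> X ;
  submodule_valP : submodule_val \in M }.

HB.instance Definition _ := [isSub for submodule_val].
HB.instance Definition _ := [Choice of submodule by <:].
HB.instance Definition _ := [SubChoice_isSubLmodule of submodule by <:].

Let submodule_norm (m : submodule) : R := `|submodule_val m|.

Let submodule_ler_normD (m n : submodule) :
  submodule_norm (m + n) <= submodule_norm m + submodule_norm n.
Proof. exact: ler_normD. Qed.

Let submodule_normrZ (a : R) (m : submodule) :
  submodule_norm (a *: m) = `|a| * submodule_norm m.
Proof. exact: normrZ. Qed.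

Let submodule_normr0_eq0 (m : submodule) : submodule_norm m = 0 -> m = 0.
Proof. by move=> /normr0_eq0 m0; apply: val_inj. Qed.

HB.instance Definition _ := Lmodule_isNormed.Build R submodule
  submodule_ler_normD submodule_normrZ submodule_normr0_eq0.

Lemma submodule_normE (m : submodule) : `|m| = `|submodule_val m|.
Proof. by []. Qed.

End submodule.

Section defs.
Context {R : realType}.

(* sigma(Z^*, Z), as the topology induced on Z^* by pointwise convergence on
   Z -> R. *)
Definition weak_star (Z : normedModType R) : topologicalType :=
  initial_topology (fun f : dual Z => (f : {ptws Z -> R^o})).

Definition diameter (Z : normedModType R) (A : set Z) : \bar R :=
  ereal_sup [set `|p.1 - p.2|%:E | p in A `*` A].

Definition unit_ball (Z : normedModType R) : set Z := [set z | `|z| <= 1].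
Arguments unit_ball : clear implicits.

Definition weak_star_relatively_open (Z : normedModType R) (U : set (dual Z)) :=
  exists2 W : set (weak_star Z), open W & U = W `&` unit_ball (dual Z).

Definition weak_star_D2P (Z : normedModType R) : Prop :=
  forall U : set (dual Z), weak_star_relatively_open U -> U !=set0 ->
    diameter U = 2%:E.

Definition L_projection (Z : normedModType R) (P : {linear Z -> Z}) : Prop :=
  (forall z, P (P z) = P z) /\ (forall z, `|z| = `|P z| + `|z - P z|).

Definition annihilator (X : normedModType R) (M : set X) : set (dual X) :=
  [set f | forall m, M m -> f m = 0].

Definition M_ideal (X : normedModType R) (M : submodClosed X) : Prop :=
  closed [set` M] /\
  exists2 P : {linear dual X -> dual X},
    L_projection P & [set f | P f = 0] = annihilator [set` M].

End defs.

(* Main.v *)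
From HB Require Import structures.
Require Import Defs.
From mathcomp Require Import all_boot all_order all_algebra.
From mathcomp Require Import all_classical all_reals all_analysis.
From mathcomp Require Import ring lra.

(** Let [P] be the L-projection on [X^*] with kernel the annihilator of [M].
    Two functionals on [X] have the same restriction to [M] exactly when they
    have the same image by [P], so comparing [f] with a norm-preserving
    extension of its restriction gives [`|P f| = `|restrict M f|]
    ([L_projection_norm_restrict]).  Since [`|f| = `|P f| + `|f - P f|], a
    functional of the unit ball of [X^*] whose restriction has norm close to
    [1] is close to its image by [P].  Hence the distance between two such
    functionals is almost the distance between their restrictions
    ([L_projection_dist]).

    Restriction is weak-star continuous and the norm is weak-star lower
    semicontinuous.  If a weak-star open [W] contains a functional of the unit
    ball of [M^*] of norm close to [1], the functionals of the unit ball of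
    [X^*] that restrict into [W] with norm close to [1] therefore form a
    nonempty relatively weak-star open set.  It has diameter [2], and so [W]
    contains points of the unit ball of [M^*] at distance almost [2]
    ([far_points_of_large_norm]).

    It remains to see that every weak-star neighbourhood of a point [f] of the
    unit ball of [M^*] meets the unit sphere ([weak_star_ball_norm_one]).  This
    amounts to [M] being infinite-dimensional, but it follows directly from the
    same lemma: applied near a functional of norm [1], it yields two functionals
    whose difference [h] is large in norm and small at prescribed points of [M].
    Some [f + t *: h] with [0 <= t <= 2] then has norm [1], and it is close to
    [f] at these points. *)

Set Implicit Arguments.
Unset Strict Implicit.
Unset Printing Implicit Defensive.
Import Order.TTheory GRing.Theory Num.Theory.
Import numFieldNormedType.Exports.

Local Open Scope classical_set_scope.
Local Open Scope ring_scope.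

(** * The Hahn-Banach theorem *)

Section hahn_banach.
Context {R : realType} {V : lmodType R} (p : V -> R).
Hypothesis pD : forall x y, p (x + y) <= p x + p y.
Hypothesis pZ : forall a x, 0 <= a -> p (a *: x) = a * p x.

(** Partial linear functionals are handled through their graphs, so that the
    union of a chain of them needs no choice of domain.  Single-valuedness is
    left out: domination by a sublinear [p] forces it, because a pair [(0, r)]
    satisfies [r <= p 0 = 0], and so does [(0, - r)]. *)
Definition linear_graph (G : set (V * R)) :=
  G (0, 0) /\ forall a x r y s,
    G (x, r) -> G (y, s) -> G (a *: x + y, a * r + s).

Definition dominated_graph (G : set (V * R)) := forall x r, G (x, r) -> r <= p x.

Lemma linear_graphZ (G : set (V * R)) a x r :
  linear_graph G -> G (x, r) -> G (a *: x, a * r).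
Proof.
by move=> [G0 Glin] Gxr; have := Glin a _ _ _ _ Gxr G0; rewrite !addr0.
Qed.

Lemma sublinear0 : p 0 = 0.
Proof. by have := pZ 0 (lexx 0); rewrite scale0r mul0r. Qed.

(** Extending [G] to [x] by the value [a] keeps it dominated iff [a] lies above
    every [r - p (u - x)] and below every [p (v + x) - s].  Subadditivity puts
    the former numbers below the latter, so their supremum will do; positive
    homogeneity then passes from [t = 1] and [t = -1] to all multiples. *)
Lemma one_step_value (G : set (V * R)) (x : V) :
  linear_graph G -> dominated_graph G ->
  exists a, forall t u r, G (u, r) -> r + t * a <= p (u + t *: x).
Proof.
move=> Glin Gdom.
pose S := [set q.2 - p (q.1 - x) | q in G].
have S0 : S !=set0 by exists (0 - p (0 - x)); exists (0, 0) => //; case: Glin.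
have Sub v s : G (v, s) -> ubound S (p (v + x) - s).
  move=> Gvs _ [[u r] Gur <-] /=.
  have := Gdom _ _ (Glin.2 1 _ _ _ _ Gur Gvs); rewrite scale1r mul1r.
  have := pD (u - x) (v + x); rewrite addrACA addNr addr0; lra.
have Ssup : has_sup S.
  by split=> //; exists (p (0 + x) - 0); apply: Sub; case: Glin.
exists (sup S) => t u r Gur.
have [t0|t0|->] := ltgtP t 0; last by rewrite scale0r mul0r !addr0; exact: Gdom.
- have nt0 : 0 < - t by rewrite oppr_gt0.
  have Gt := linear_graphZ (- t)^-1 Glin Gur.
  have : (- t)^-1 * r - p ((- t)^-1 *: u - x) <= sup S.
    by apply: ub_le_sup; [exact: Ssup.2|exists ((- t)^-1 *: u, (- t)^-1 * r)].
  rewrite -(ler_pM2l nt0) mulrBr mulrA divff ?gt_eqF// mul1r -(pZ _ (ltW nt0)).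
  rewrite scalerBr scalerA divff ?gt_eqF// scale1r scaleNr opprK; lra.
- have Gt := linear_graphZ t^-1 Glin Gur.
  have : sup S <= p (t^-1 *: u + x) - t^-1 * r.
    by apply: ge_sup => //; exact: Sub.
  rewrite -(ler_pM2l t0) mulrBr mulrA divff ?gt_eqF// mul1r -(pZ _ (ltW t0)).
  rewrite scalerDr scalerA divff ?gt_eqF// scale1r; lra.
Qed.

(** Zorn's lemma gives a maximal dominated linear graph containing [F], and
    [one_step_value] shows that its domain is everything. *)
Theorem hahn_banach (F : set (V * R)) :
  linear_graph F -> dominated_graph F ->
  exists e : V -> R, [/\ linear (e : V -> R^o),
    forall x r, F (x, r) -> e x = r & forall x, e x <= p x].
Proof.
move=> Flin Fdom.
(* The property bears on A `|` F rather than on graphs A containing F, because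
   the empty chain, whose union is empty, must satisfy it too. *)
pose P : set (set (V * R)) :=
  [set A | linear_graph (A `|` F) /\ dominated_graph (A `|` F)].
have [|A [[Glin Gdom] Amax]] := @Zorn_bigcup _ P.
  move=> C CP Ctot.
  have up q q' : (\bigcup_(X in C) X `|` F) q -> (\bigcup_(X in C) X `|` F) q' ->
      (F q /\ F q') \/ exists2 B, C B & (B `|` F) q /\ (B `|` F) q'.
    move=> [[B CB Bq]|Fq] [[B' CB' Bq']|Fq'].
    - have [sB|sB] := Ctot _ _ CB CB'.
        by right; exists B' => //; split; left => //; exact: sB.
      by right; exists B => //; split; left => //; exact: sB.
    - by right; exists B => //; split; [left|right].
    - by right; exists B' => //; split; [right|left].
    - by left.
  split; last first.
    move=> x r [[B CB Bxr]|]; last exact: Fdom.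
    by apply: (CP _ CB).2; left.
  split=> [|a x r y s Gxr Gys]; first by right; case: Flin.
  have [[Fxr Fys]|[B CB [Bxr Bys]]] := up _ _ Gxr Gys.
    by right; exact: Flin.2.
  by have [|] := (CP _ CB).1.2 a _ _ _ _ Bxr Bys; [left; exists B|right].
set G := A `|` F in Glin Gdom.
have Gtot x : exists r, G (x, r).
  apply: contrapT => /forallNP xG.
  have [a Ga] := one_step_value x Glin Gdom.
  pose G' : set (V * R) :=
    [set q | exists t u r, G (u, r) /\ q = (u + t *: x, r + t * a)].
  have GG' : G `<=` G'.
    by move=> [u r] Gur; exists 0, u, r; rewrite scale0r mul0r !addr0.
  have G'F : G' `|` F = G'.
    by apply/setUidPl => q Fq; apply: GG'; right.
  apply: (Amax G').
    split=> [q Aq|]; first by apply: GG'; left.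
    move=> /(_ (x, a)); apply: contra_not (xG a) => /(_ _) G'A; left; apply: G'A.
    by exists 1, 0, 0; rewrite scale1r mul1r !add0r; split=> //; case: Glin.
  rewrite /P/= G'F; split; last first.
    by move=> _ _ [t [u [r [Gur [-> ->]]]]]; exact: Ga.
  split; first by apply: GG'; case: Glin.
  move=> b _ _ _ _ [t [u [r [Gur [-> ->]]]]] [t' [u' [r' [Gur' [-> ->]]]]].
  exists (b * t + t'), (b *: u + u'), (b * r + r'); split; first exact: Glin.2.
  congr pair; last by ring.
  by rewrite scalerDr scalerDl scalerA addrACA.
have Guniq x r s : G (x, r) -> G (x, s) -> r = s.
  move=> Gxr Gxs; apply/eqP; rewrite eq_le.
  have H r' s' : G (x, r') -> G (x, s') -> s' <= r'.
    move=> Gr Gs; have := Gdom _ _ (Glin.2 (-1) _ _ _ _ Gr Gs).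
    rewrite scaleN1r addNr sublinear0; lra.
  by rewrite !H.
have [e Ge] := choice Gtot.
exists e; split.
- by move=> a x y; apply: (Guniq (a *: x + y)) => //; exact: Glin.2.
- by move=> x r Fxr; apply: (Guniq x) => //; right.
- by move=> x; exact: Gdom.
Qed.

End hahn_banach.

(** * Duals of normed spaces and the weak-star topology *)

Section dual_space.
Context {R : realType}.
Implicit Types Z : normedModType R.

Lemma dual_ext Z (f g : dual Z) : f =1 g -> f = g.
Proof. by move=> fg; apply/val_inj/funext. Qed.

Lemma dual_norm_bound Z (f : dual Z) z : `|f z| <= `|f| * `|z|.
Proof.
have [->|z0] := eqVneq z 0; first by rewrite raddf0 !normr0 mulr0.
have nz0 : 0 < `|z| by rewrite normr_gt0.
have : `|f (`|z|^-1 *: z)| <= `|f|.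
  by apply: dual_norm_ub; rewrite normrZ normfV normr_id mulVf ?gt_eqF.
rewrite linearZ /= normrM normfV normr_id -(ler_pM2l nz0) mulrA divff ?gt_eqF//.
by rewrite mul1r mulrC.
Qed.

Lemma bounded_linear_dual_pred Z (e : Z -> R^o) (c : R) :
  linear e -> 0 <= c -> (forall z, `|e z| <= c * `|z|) -> e \in @dual_pred R Z.
Proof.
move=> elin c0 ec; rewrite inE; split=> //.
pose E : {linear Z -> R^o} :=
  HB.pack e (GRing.isLinear.Build R Z R^o *:%R e elin).
suff : continuous E by [].
apply/linear_bounded_continuous/bounded_funP => r; exists (c * r) => z zr.
exact: le_trans (ec z) (ler_wpM2l c0 zr).
Qed.

Lemma dual_of_bounded Z (e : Z -> R^o) (c : R) :
  linear e -> 0 <= c -> (forall z, `|e z| <= c * `|z|) ->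
  exists2 f : dual Z, f =1 e & `|f| <= c.
Proof.
move=> elin c0 ec; exists (Dual (bounded_linear_dual_pred elin c0 ec)) => //.
apply: dual_norm_le => z z1.
by apply: le_trans (ec z) _; rewrite ler_piMr.
Qed.

(** What [hahn_banach] asks of the bound [c * `|x|]. *)
Lemma sublinear_norm Z (c : R) : 0 <= c ->
  (forall x y : Z, c * `|x + y| <= c * `|x| + c * `|y|) /\
  (forall a (x : Z), 0 <= a -> c * `|a *: x| = a * (c * `|x|)).
Proof.
move=> c0; split=> [x y|a x a0]; first by rewrite -mulrDr ler_wpM2l// ler_normD.
by rewrite normrZ ger0_norm// mulrCA.
Qed.

Lemma hahn_banach_norm Z (c : R) (F : set (Z * R)) : 0 <= c ->
  linear_graph F -> (forall x r, F (x, r) -> r <= c * `|x|) ->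
  exists2 f : dual Z, `|f| <= c & forall x r, F (x, r) -> f x = r.
Proof.
move=> c0 Flin Fc; have [pD pZ] := sublinear_norm Z c0.
have [e [elin eF ec]] := hahn_banach pD pZ Flin Fc.
have [|f fe fc] := dual_of_bounded elin c0.
  move=> z; rewrite ler_norml ec andbT lerNl.
  have e0 : e 0 = 0 by have := elin (-1) 0 0; rewrite scaler0 addr0 scaleN1r addNr.
  have := elin (-1) z 0; rewrite scaleN1r addr0 e0 addr0 scaleN1r => <-.
  by rewrite (le_trans (ec _))// normrN.
by exists f => // x r Fxr; rewrite fe; exact: eF.
Qed.

(** The functional [t *: z |-> t * `|z|] on the line of [z] has norm [1], and
    Hahn-Banach extends it to the whole space. *)
Lemma exists_norm_one Z : (exists z : Z, z != 0) -> exists f : dual Z, `|f| = 1.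
Proof.
move=> [z z0]; have nz0 : 0 < `|z| by rewrite normr_gt0.
have [|||f f1 fz] := @hahn_banach_norm Z 1 [set q | exists t, q = (t *: z, t * `|z|)].
- by [].
- split; first by exists 0; rewrite scale0r mul0r.
  move=> a _ _ _ _ [t [-> ->]] [t' [-> ->]]; exists (a * t + t').
  by rewrite scalerDl scalerA mulrDl mulrA.
- by move=> _ _ [t [-> ->]]; rewrite mul1r normrZ ler_wpM2r// ler_norm.
exists f; apply/eqP; rewrite eq_le f1 /=.
have := dual_norm_bound f z; rewrite (fz z `|z|); last first.
  by exists 1; rewrite scale1r mul1r.
by rewrite normr_id ler_pMl.
Qed.

(** The basic neighbourhoods of [f] for pointwise convergence. *)
Definition weak_star_ball Z (f : dual Z) (s : seq Z) (e : R) : set (dual Z) :=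
  [set g | forall z, z \in s -> `|g z - f z| < e].

Lemma weak_star_eval_continuous Z (z : Z) :
  continuous (fun f : weak_star Z => (f : dual Z) z : R^o).
Proof.
move=> f.
have : {ptws, (fun g : weak_star Z => (dual_fun g : {ptws Z -> R^o})) @ f --> dual_fun f}.
  exact: (@initial_continuous (dual Z) {ptws Z -> R^o}).
by move=> /pointwise_cvgP; apply; apply: fmap_filter; apply: nbhs_filter.
Qed.

(** The sets [weak_star_ball f s e] form a base of a filter that converges to [f]
    at every point, hence in the weak-star topology; and they are finite
    intersections of preimages of balls by evaluations. *)
Lemma weak_star_openP Z (W : set (weak_star Z)) :
  open W <-> forall f, W f -> exists s, exists2 e, 0 < e & weak_star_ball f s e `<=` W.
Proof.
split=> [Wop f Wf|Wb].
  pose B : set (seq Z * R) := [set q | 0 < q.2].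
  pose F : set_system (dual Z) := filter_from B (fun q => weak_star_ball f q.1 q.2).
  have FF : Filter F.
    apply: filter_from_filter; first by exists ([::], 1); rewrite /B/=.
    move=> [s e] [s' e'] /= e0 e'0; exists (s ++ s', Num.min e e').
      by rewrite /B/= lt_min e0.
    move=> g gb; split=> z zs; have := gb z; rewrite /= mem_cat zs ?orbT;
      by move=> /(_ isT); rewrite lt_min => /andP[].
  have [[s e] /= e0 sW] : F W; last by exists s, e.
  case: Wop => O Oop OW; rewrite -OW in Wf *.
  have : {ptws, (fun g : dual Z => (g : {ptws Z -> R^o})) @ F --> (f : {ptws Z -> R^o})}.
    apply/pointwise_cvgP => z; apply/cvgrPdist_lt => e e0.
    exists ([:: z], e) => //= g /(_ z); rewrite mem_head => /(_ isT).
    by rewrite distrC.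
  by apply; exact: open_nbhs_nbhs.
rewrite openE => f /Wb[s [e e0 sW]]; apply: filterS sW _.
elim: s => [|z s IHs]; first by apply: filterS filterT.
have /cvgrPdist_lt/(_ _ e0) := @weak_star_eval_continuous Z z f.
rewrite near_simpl => zs; near=> g => y; rewrite inE => /orP[/eqP ->|].
  by rewrite distrC; near: g.
by move: y; change (weak_star_ball f s e g); near: g.
Unshelve. all: by end_near. Qed.

Lemma weak_star_ball_open Z (f : dual Z) s e :
  open (weak_star_ball f s e : set (weak_star Z)).
Proof.
apply/weak_star_openP => g gb.
elim: s gb => [|z s IHs] gb; first by exists [::], 1.
have [|t [d d0 td]] := IHs; first by move=> y ys; apply: gb; rewrite inE ys orbT.
have gz : 0 < e - `|g z - f z| by rewrite subr_gt0 gb// mem_head.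
exists (z :: t), (Num.min d (e - `|g z - f z|)); first by rewrite lt_min d0.
move=> h hb y; rewrite inE => /orP[/eqP ->|ys].
  have := hb z (mem_head _ _); rewrite lt_min => /andP[_].
  by have := ler_distD (g z) (h z) (f z); lra.
apply: td ys => x xt.
by have := hb x; rewrite inE xt orbT lt_min => /(_ isT) /andP[].
Qed.

(** Lower semicontinuity of the dual norm: it is a supremum of weak-star
    continuous functions. *)
Lemma weak_star_norm_gt_open Z (c : R) :
  open ([set f | c < `|f|] : set (weak_star Z)).
Proof.
apply/weak_star_openP => f /= cf.
have [z z1 cz] : exists2 z, `|z| <= 1 & c < `|f z|.
  apply: contrapT => H; move: cf; apply/negP; rewrite -leNgt.
  apply: dual_norm_le => z z1; rewrite leNgt; apply/negP => cz.
  by apply: H; exists z.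
exists [:: z], (`|f z| - c); first by rewrite subr_gt0.
move=> g /(_ z (mem_head _ _)) gz.
have gub : `|g z| <= `|(g : dual Z)| by exact: dual_norm_ub.
apply: lt_le_trans gub.
have := le_lt_trans (lerB_dist (f z) (g z)).
by rewrite distrC => /(_ _ gz); rewrite ltrD2l ltrN2.
Qed.

Lemma diameter_le2 Z (A : set Z) :
  (forall z, A z -> `|z| <= 1) -> (diameter A <= 2%:E)%E.
Proof.
move=> A1; apply: ge_ereal_sup => _ [[x y] [/= Ax Ay] <-].
rewrite lee_fin (le_trans (ler_normB _ _))//.
by have := A1 _ Ax; have := A1 _ Ay; lra.
Qed.

(** A subset of the unit ball has diameter at most [2], so only the lower bound
    is at stake. *)
Lemma diameter_eq2P Z (A : set Z) : (forall z, A z -> `|z| <= 1) ->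
  diameter A = 2%:E <->
  forall d, 0 < d -> exists x y, [/\ A x, A y & 2 - d < `|x - y|].
Proof.
move=> A1; split=> [A2 d d0|H].
  have : ((2 - d)%:E < diameter A)%E by rewrite A2 lte_fin; lra.
  move=> /ereal_sup_gt[_ [[x y] [/= Ax Ay] <-]]; rewrite lte_fin => dxy.
  by exists x, y.
apply/eqP; rewrite eq_le diameter_le2//=; apply/lee_addgt0Pr => d d0.
have [x [y [Ax Ay dxy]]] := H d d0.
rewrite -leeBlDr// -EFinB; apply: ereal_sup_ge.
exists `|x - y|%:E; first by exists (x, y).
by rewrite lee_fin ltW.
Qed.

End dual_space.

(** * Restriction of functionals to a subspace *)

Section restriction.
Context {R : realType} {X : normedModType R} (M : submodClosed X).

Lemma restrict_subproof (f : dual X) :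
  (fun m : submodule M => f (submodule_val m)) \in @dual_pred R (submodule M).
Proof.
apply: (@bounded_linear_dual_pred _ _ _ `|f|) => // [a m n|m].
  exact: dual_linear.
exact: dual_norm_bound.
Qed.

Definition restrict (f : dual X) : dual (submodule M) :=
  Dual (restrict_subproof f).

Lemma restrictB f g : restrict (f - g) = restrict f - restrict g.
Proof. exact: dual_ext. Qed.

Lemma restrict_norm_le f : `|restrict f| <= `|f|.
Proof. by apply: dual_norm_le => m m1; exact: (dual_norm_ub f). Qed.

Lemma restrict_weak_star_continuous :
  continuous (restrict : weak_star X -> weak_star (submodule M)).
Proof.
apply/continuousP => W /weak_star_openP Wop; apply/weak_star_openP => f /Wop.
move=> [s [e e0 sW]]; exists (map (@submodule_val R X M) s), e => // g gb.
by apply: sW => m ms; apply: gb; exact: map_f.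
Qed.

(** Hahn-Banach for the graph of [f] and the sublinear map [`|f| * `|x|]. *)
Lemma norm_preserving_extension (f : dual (submodule M)) :
  exists2 e : dual X, restrict e = f & `|e| <= `|f|.
Proof.
have [||e ef eval] := @hahn_banach_norm R X `|f|
  [set q | exists m : submodule M, q = (submodule_val m, f m)] (normr_ge0 f).
- split; first by exists 0; rewrite raddf0.
  move=> a _ _ _ _ [m [-> ->]] [n [-> ->]]; exists (a *: m + n).
  by rewrite linearP.
- move=> _ _ [m [-> ->]]; apply: le_trans (ler_norm _) _.
  exact: dual_norm_bound.
by exists e => //; apply: dual_ext => m; apply: eval; exists m.
Qed.

Lemma restrict_eqP f g :
  restrict f = restrict g <-> annihilator [set` M] (f - g).
Proof.
split=> [fg m mM|fg].
  apply/eqP; rewrite dualDE subr_eq0; apply/eqP.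
  exact: (congr1 (fun h : dual (submodule M) => h (Submodule mM)) fg).
apply: dual_ext => m; apply/eqP; rewrite -subr_eq0; apply/eqP.
exact: (fg _ (submodule_valP m)).
Qed.

End restriction.

(** * L-projections and restriction *)

Section M_ideals.
Context {R : realType} {X : normedModType R} (M : submodClosed X).
Variable P : {linear dual X -> dual X}.
Hypothesis PL : L_projection P.
Hypothesis kerP : [set f | P f = 0] = annihilator [set` M].

(** A norm-preserving extension [e] of [restrict M f] has [P e = P f], since
    [e - f] lies in the kernel of [P], and [P] is contractive; conversely [P f]
    itself restricts to [restrict M f]. *)
Lemma L_projection_norm_restrict f : `|P f| = `|restrict M f|.
Proof.
have PE f' g' : restrict M f' = restrict M g' <-> P f' = P g'.
  rewrite restrict_eqP -kerP/= linearB/=.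
  by split=> [/eqP|->]; rewrite ?subrr// subr_eq0 => /eqP.
apply/eqP; rewrite eq_le; apply/andP; split.
  have [e ef ne] := norm_preserving_extension (restrict M f).
  rewrite -(PE e f).1//; apply: le_trans ne.
  by rewrite [leRHS](PL.2 e) lerDl.
have /PE <- : P (P f) = P f by exact: PL.1.
exact: restrict_norm_le.
Qed.

(** By the norm identity of an L-projection, [`|f - P f| = `|f| - `|P f| < d],
    and likewise for [g]: all but [2 * d] of [`|f - g|] is seen by [P], that is,
    by restriction to [M]. *)
Lemma L_projection_dist f g d :
  `|f| <= 1 -> `|g| <= 1 -> 1 - d < `|restrict M f| -> 1 - d < `|restrict M g| ->
  `|f - g| < `|restrict M f - restrict M g| + 2 * d.
Proof.
move=> f1 g1 df dg.
have small h : `|h| <= 1 -> 1 - d < `|restrict M h| -> `|h - P h| < d.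
  rewrite -L_projection_norm_restrict; have := PL.2 h; lra.
have := PL.2 (f - g); rewrite L_projection_norm_restrict restrictB.
have -> : f - g - P (f - g) = (f - P f) - (g - P g).
  by rewrite linearB/= !opprD !opprK addrACA.
have := ler_normB (f - P f) (g - P g).
by have := small _ f1 df; have := small _ g1 dg; lra.
Qed.

End M_ideals.

(** * Diameter two in the dual of an M-ideal *)

Section M_ideal_D2P.
Context {R : realType} {X : normedModType R} (M : submodClosed X).
Hypothesis M_ideal_X : M_ideal M.
Hypothesis D2P_X : weak_star_D2P X.
Local Notation MD := (dual (submodule M)).

(** The unit ball functionals on [X] that restrict into [W] with norm above
    [1 - d] form a relatively weak-star open set of diameter [2].  Two of them at
    distance more than [2 - d] have, by [L_projection_dist], restrictions at
    distance more than [2 - 3 * d]. *)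
Lemma far_points_of_large_norm (W : set (weak_star (submodule M))) (f : MD) d :
  open W -> W f -> `|f| <= 1 -> 0 < d -> 1 - d < `|f| ->
  exists g h : MD, [/\ W g /\ `|g| <= 1, W h /\ `|h| <= 1 & 2 - 3 * d < `|g - h|].
Proof.
move=> Wop Wf f1 d0 fd; have [_ [P PL kerP]] := M_ideal_X.
pose W' : set (weak_star (submodule M)) := W `&` [set g | 1 - d < `|g|].
have W'op : open W' by apply: openI => //; exact: weak_star_norm_gt_open.
pose V : set (dual X) :=
  ((restrict M : weak_star X -> weak_star (submodule M)) @^-1` W')
  `&` @unit_ball R (dual X).
have V1 h : V h -> `|h| <= 1 by case.
have /(diameter_eq2P V1)/(_ d d0) : diameter V = 2%:E.
  apply: D2P_X.
    exists ((restrict M : weak_star X -> weak_star (submodule M)) @^-1` W') => //.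
    by apply: open_comp => // ? _; exact: restrict_weak_star_continuous.
  have [e ef e1] := norm_preserving_extension f.
  by exists e; split; [rewrite /W'/preimage/= ef|exact: le_trans f1].
move=> [g [h [[[Wg dg] g1] [[Wh dh] h1] dgh]]].
exists (restrict M g), (restrict M h); split.
- by split=> //; apply: le_trans (restrict_norm_le M g) g1.
- by split=> //; apply: le_trans (restrict_norm_le M h) h1.
by have := L_projection_dist PL kerP g1 h1 dg dh; move: dgh; lra.
Qed.

(** Two far apart functionals that are both close on [s] to a functional of
    norm [1] have a large difference that almost vanishes on [s]. *)
Lemma large_functional_small_on (s : seq (submodule M)) (e : R) :
  (exists m : submodule M, m != 0) -> 0 < e ->
  exists2 h : MD, 1 <= `|h| & forall m, m \in s -> `|h m| < e.
Proof.
move=> /exists_norm_one[f f1] e0; have e20 : 0 < e / 2 by lra.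
(* 2 - 3 * d is the desired lower bound 1 when d = 1 / 3. *)
have d0 : 0 < 1 / 3 :> R by lra.
have [|||g [h [[fg _] [fh _] gh]]] :=
  far_points_of_large_norm (weak_star_ball_open f s (e / 2)) (f := f) _ _ d0.
- by move=> m ms; rewrite subrr normr0.
- by rewrite f1.
- by rewrite f1; lra.
exists (g - h); first by move: gh; lra.
move=> m ms; have -> : (g - h) m = (g m - f m) - (h m - f m).
  by rewrite opprB addrA subrK.
apply: le_lt_trans (ler_normB _ _) _.
by rewrite (splitr e); apply: ltrD; [exact: fg|exact: fh].
Qed.

(** Adding to [f] a multiple of a functional [h] that is small on [s] hardly
    changes it there, while the norm of [f + t *: h] is at most [1] at [t = 0] and,
    as [`|h| >= 1], at least [1] at [t = 2]. *)
Lemma weak_star_ball_norm_one (f : MD) (s : seq (submodule M)) (e : R) :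
  (exists m : submodule M, m != 0) -> `|f| <= 1 -> 0 < e ->
  exists2 g : MD, `|g| = 1 & weak_star_ball f s e g.
Proof.
move=> M0 f1 e0; have e20 : 0 < e / 2 by lra.
have [h h1 hs] := large_functional_small_on s M0 e20.
pose phi (t : R) : R := `|f + t *: h|.
have phi_cont : continuous phi.
  move=> t; apply/cvgrPdist_le => d d0.
  have h0 : 0 < `|h| by lra.
  apply/nbhs_normP; exists (d / `|h|) => /=; first exact: divr_gt0.
  move=> u /=; rewrite ltr_pdivlMr// => tu.
  rewrite (le_trans (ler_dist_dist _ _))// opprD addrACA subrr add0r -scalerBl.
  by rewrite normrZ ltW.
have phi0 : phi 0 <= 1 by rewrite /phi scale0r addr0.
have phi2 : 1 <= phi 2.
  have := ler_normB (f + 2 *: h) f; rewrite addrAC subrr add0r normrZ normr_nat /phi; lra.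
have phi1 : Num.min (phi 0) (phi 2) <= 1 <= Num.max (phi 0) (phi 2).
  by rewrite ge_min le_max; apply/andP; split; apply/orP; [left|right].
have [t] := IVT (ler0n R 2) (continuous_subspaceT phi_cont) phi1.
rewrite in_itv/= => /andP[t0 t2] phit.
exists (f + t *: h) => // m ms.
rewrite dualDE dualZE addrAC subrr add0r normrM ger0_norm//.
apply: le_lt_trans (ler_wpM2r (normr_ge0 _) t2) _.
by rewrite mulrC -ltr_pdivlMr//; exact: hs.
Qed.

End M_ideal_D2P.

Theorem proposition5 (R : realType) (X : completeNormedModType R)
    (M : submodClosed X) (M_neq0 : exists2 m : X, m \in M & m != 0)
    (M_ideal_X : M_ideal M) (D2P_X : weak_star_D2P X) :
  weak_star_D2P (submodule M).
Proof.
have M0 : exists m : submodule M, m != 0.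
  have [m mM m0] := M_neq0; exists (Submodule mM).
  by apply: contra_neq m0 => /(congr1 (@submodule_val _ _ _)).
move=> _ [W Wop ->] [f [Wf f1]].
apply/diameter_eq2P => [g [] //|d d0]; have d30 : 0 < d / 3 by lra.
have [s [e e0 sW]] := (weak_star_openP W).1 Wop f Wf.
have [g g1 sg] := weak_star_ball_norm_one M_ideal_X D2P_X s M0 f1 e0.
have [||g' [h [[Wg' g'1] [Wh h1] g'h]]] :=
  far_points_of_large_norm M_ideal_X D2P_X Wop (sW _ sg) _ d30.
- by rewrite g1.
- by rewrite g1; lra.
exists g', h; split; [by []|by []|].
by move: g'h; lra.
Qed.
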